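(* Let $\mathbb{K}$ denote either $\mathbb{R}$ or $\mathbb{C}$, let $d \geq 1$, and let $\mathcal{A}$ be a bounded, irreducible, nonempty subset of $\mathbf{M}_d(\mathbb{K})$. Suppose that the limit semigroup $\mathcal{S}(\mathcal{A})$ has the following transitivity property: for every pair of nonzero vectors $v_1, v_2 \in \mathbb{K}^d$, there exist $B_1, B_2 \in \mathcal{S}(\mathcal{A})$ and a nonzero $\lambda \in \mathbb{K}$ such that $B_1 v_1 = \lambda v_2$ and $B_2 v_2 = \lambda^{-1} v_1$. Then $\mathcal{A}$ has a unique Barabanov norm.
   Context: $\mathbf{M}_d(\mathbb{K})$ is the set of $d \times d$ matrices over $\mathbb{K}$ with its usual topology as a normed vector space, and $\|\cdot\|$ denotes the operator norm induced by the Euclidean norm. For a bounded nonempty set $\mathcal{A} \subset \mathbf{M}_d(\mathbb{K})$ and $n \geq 1$, write $\mathcal{A}^n := \{A_{i_1} \cdots A_{i_n} : A_{i_1}, \ldots, A_{i_n} \in \mathcal{A}\}$ for the set of all products of $n$ elements of $\mathcal{A}$. The joint spectral radius of $\mathcal{A}$ is $\varrho(\mathcal{A}) := \lim_{n\to\infty} \sup\{\|A\|^{1/n} : A \in \mathcal{A}^n\}$; this limit exists and is independent of the norm used. $\mathcal{A}$ is reducible if there is a linear subspace of $\mathbb{K}^d$ of dimension strictly between $0$ and $d$ which is preserved by every element of $\mathcal{A}$; otherwise it is irreducible. $\mathcal{A}$ is relatively product bounded if $\varrho(\mathcal{A})>0$ and the set $\bigcup_{n \geq 1} \varrho(\mathcal{A})^{-n}\mathcal{A}^n$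 is bounded. It is a known fact that irreducible sets have $\varrho(\mathcal{A})>0$ and are relatively product bounded. For relatively product bounded $\mathcal{A}$, the limit semigroup of $\mathcal{A}$ is $$\mathcal{S}(\mathcal{A}) := \bigcap_{m=1}^\infty \overline{\bigcup_{n=m}^\infty \varrho(\mathcal{A})^{-n} \mathcal{A}^n} \subset \mathbf{M}_d(\mathbb{K}).$$ A Barabanov norm for $\mathcal{A}$ is a norm $|\!|\!|\cdot|\!|\!|$ on $\mathbb{K}^d$ such that $\varrho(\mathcal{A})\,|\!|\!|v|\!|\!| = \sup\{|\!|\!|Av|\!|\!| : A \in \mathcal{A}\}$ for every $v \in \mathbb{K}^d$. It is a known fact (due to Barabanov) that every compact irreducible set of matrices admits a Barabanov norm. $\mathcal{A}$ is said to have a unique Barabanov norm if it has at least one Barabanov norm and any two Barabanov norms for $\mathcal{A}$ are equal up to multiplication by a positive scalar constant. *)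

(* Defs.v *)
From HB Require Import structures.
From mathcomp Require Import all_boot all_order all_algebra.
From mathcomp Require Import complex.
From mathcomp Require Import all_classical all_reals all_analysis.

Set Implicit Arguments.
Unset Strict Implicit.
Unset Printing Implicit Defensive.

Import Order.TTheory GRing.Theory Num.Theory.
Import numFieldNormedType.Exports.

Local Open Scope classical_set_scope.
Local Open Scope ring_scope.

Variant ground_field := RealNumbers | ComplexNumbers.

Definition base_field (R : realType) (F : ground_field) : numFieldType :=
  match F with
  | RealNumbers => R
  | ComplexNumbers => R[i]
  end.

(* The norm of a [numFieldType] takes its values in the field itself; suprema
   and roots are taken in [R], hence an [R]-valued absolute value. *)
Definition modulus (R : realType) (F : ground_field) : base_field R F -> R :=
  match F with
  | RealNumbers => fun x : R => `|x|
  | ComplexNumbers => fun z : R[i] => complex.Re `|z|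
  end.

Definition of_real (R : realType) (F : ground_field) : R -> base_field R F :=
  match F with
  | RealNumbers => fun x : R => x
  | ComplexNumbers => fun x : R => x%:C%C
  end.

Section JointSpectralRadius.
Variables (R : realType) (F : ground_field) (d : nat).
Local Notation K := (base_field R F).
Implicit Types (A : set 'M[K]_d) (N : 'cV[K]_d -> R).

Definition euclidean_norm (v : 'cV[K]_d) : R :=
  Num.sqrt (\sum_(i < d) modulus (v i 0) ^+ 2).

Definition operator_norm (B : 'M[K]_d) : R :=
  sup [set euclidean_norm (B *m v) | v in [set v | euclidean_norm v <= 1]].

Definition bounded_matrices A : Prop :=
  exists M : R, forall B, A B -> operator_norm B <= M.

Definition products A (n : nat) : set 'M[K]_d :=
  [set \big[mulmx/1%:M]_(i < n) B i | B in [set B : 'I_n -> 'M[K]_d |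
                                             forall i, A (B i)]].

(* The term of index 0 does not affect the limit. *)
Definition joint_spectral_radius A : R :=
  lim ((fun n : nat =>
    sup [set operator_norm B `^ n%:R^-1 | B in products A n]) @ \oo).

Definition reducible_matrices A : Prop :=
  exists V : {vspace 'cV[K]_d}, (0 < \dim V < d)%N /\
    forall B, A B -> forall v, v \in V -> B *m v \in V.

Definition irreducible_matrices A : Prop := ~ reducible_matrices A.

(* When the joint spectral radius is 0 this uses the convention 0^-1 = 0. For
   d >= 1, a bounded nonempty irreducible [A] has positive joint spectral radius
   unless d = 1 and A = {0}, in which case [limit_semigroup A] is {0}. *)
Definition limit_semigroup A : set 'M[K]_d :=
  \bigcap_(m in [set m : nat | (1 <= m)%N])
    closure (\bigcup_(n in [set n : nat | (m <= n)%N])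
      [set of_real F (joint_spectral_radius A ^- n) *: B | B in products A n]).

Definition is_norm N : Prop :=
  [/\ forall v, 0 <= N v,
      forall v, N v = 0 -> v = 0,
      forall (c : K) v, N (c *: v) = modulus c * N v &
      forall u v, N (u + v) <= N u + N v].

Definition barabanov_norm A N : Prop :=
  is_norm N /\
  forall v, joint_spectral_radius A * N v = sup [set N (B *m v) | B in A].

Definition has_unique_barabanov_norm A : Prop :=
  (exists N, barabanov_norm A N) /\
  forall N1 N2, barabanov_norm A N1 -> barabanov_norm A N2 ->
    exists2 c : R, 0 < c & forall v, N2 v = c * N1 v.

End JointSpectralRadius.

(* Main.v *)
(* Write rho for the joint spectral radius.

   Uniqueness: an element B of the limit semigroup is a limit of products
   rho^-n P, so it is a contraction for every Barabanov norm N.  Applied to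
   B1 v1 = lambda v2 and B2 v2 = lambda^-1 v1 this gives
   N v1 = |lambda| N v2, a ratio that does not depend on N.

   Existence: transitivity is used in place of irreducibility.  It forces
   rho > 0, since otherwise the limit semigroup would be {0}.  Some nonzero
   vector has a bounded orbit under the products rho^-n P: otherwise, by
   compactness of the unit sphere, every vector could be expanded by a factor 4
   within a bounded number of steps, and the products would grow faster than
   rho^n.  Transitivity spreads this bound to every vector.  Hence
   v |-> limsup_n sup { rho^-n |P v| : P in A^n } is finite; it is positive on
   v <> 0 because some B in the limit semigroup has B v <> 0, and it is a
   Barabanov norm.

   The auxiliary norm |.| is the l^1 norm, whose triangle inequality is
   immediate, so that Minkowski's inequality for the Euclidean norm is not
   needed. *)
Require Import Defs.
From mathcomp Require Import all_boot all_order all_algebra.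
From mathcomp Require Import complex.
From mathcomp Require Import all_classical all_reals all_analysis.
From mathcomp Require Import ring lra.

Set Implicit Arguments.
Unset Strict Implicit.
Unset Printing Implicit Defensive.

Import Order.TTheory GRing.Theory Num.Theory.
Import numFieldNormedType.Exports.

Local Open Scope classical_set_scope.
Local Open Scope ring_scope.

(** * Real-valued absolute value on the ground field *)

Section Modulus.
Variables (R : realType) (F : ground_field).
Local Notation K := (base_field R F).
Implicit Types x y : K.

(** The basic properties of [modulus] are pulled back from the field-valued norm along this
    identity, through the order embedding [of_real]. *)
Lemma norm_modulus x : `|x| = of_real F (modulus x).
Proof.
case: F x => x //=; rewrite RRe_real //; exact: ger0_real (normr_ge0 x).
Qed.

Lemma modulus_of_real (r : R) : (0 <= r) -> modulus (of_real F r) = r.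
Proof. by case: F => /= r0; rewrite ?normc_def /= ?expr0n /= ?addr0 ?sqrtr_sqr ger0_norm. Qed.

Lemma ltr_of_real (r s : R) : (of_real F r < of_real F s) = (r < s).
Proof. by case: F => //=; rewrite ltcR. Qed.

Lemma of_real0 : of_real F 0 = 0 :> K.
Proof. by case: F. Qed.

Lemma of_realM (r s : R) : of_real F (r * s) = of_real F r * of_real F s.
Proof. by case: F => //=; rewrite rmorphM. Qed.

Lemma of_realD (r s : R) : of_real F (r + s) = of_real F r + of_real F s.
Proof. by case: F => //=; rewrite rmorphD. Qed.

Lemma of_real_inj : injective (@of_real R F).
Proof. by case: F => //= r s /complexI. Qed.

Lemma ler_of_real (r s : R) : (of_real F r <= of_real F s) = (r <= s).
Proof. by rewrite !le_eqVlt ltr_of_real (inj_eq of_real_inj). Qed.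

Lemma modulus_ge0 x : 0 <= modulus x.
Proof. by rewrite -ler_of_real of_real0 -norm_modulus. Qed.

Lemma modulus0 : modulus (0 : K) = 0.
Proof. by apply: of_real_inj; rewrite -norm_modulus normr0 of_real0. Qed.

Lemma modulus_eq0 x : (modulus x == 0) = (x == 0).
Proof. by rewrite -(inj_eq of_real_inj) -norm_modulus of_real0 normr_eq0. Qed.

Lemma modulusM x y : modulus (x * y) = modulus x * modulus y.
Proof. by apply: of_real_inj; rewrite of_realM -!norm_modulus normrM. Qed.

Lemma modulusN x : modulus (- x) = modulus x.
Proof. by apply: of_real_inj; rewrite -!norm_modulus normrN. Qed.

Lemma modulus1 : modulus (1 : K) = 1.
Proof. by apply: of_real_inj; rewrite -norm_modulus normr1; case: F. Qed.

Lemma modulusV x : modulus x^-1 = (modulus x)^-1.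
Proof.
have [->|x0] := eqVneq x 0; first by rewrite invr0 modulus0 invr0.
have m0 : modulus x != 0 by rewrite modulus_eq0.
by apply: (mulfI m0); rewrite -modulusM !divff // modulus1.
Qed.

Lemma ler_modulusD x y : modulus (x + y) <= modulus x + modulus y.
Proof. by rewrite -ler_of_real of_realD -!norm_modulus ler_normD. Qed.

End Modulus.

(** * Bounded sequences of scalars converge along ultrafilters *)

Section Cluster.
Variables (R : realType) (F : ground_field).
Local Notation K := (base_field R F).

(** The image of [U] lives on the compact segment [-M, M], so it has a cluster point; an ultrafilter
    converges to each of its cluster points. *)
Lemma ultra_bounded_real (U : set_system nat) (x : nat -> R) (M : R) :
  UltraFilter U -> (forall n, `|x n| <= M) ->
  exists a : R, forall e, 0 < e -> U [set n | `|x n - a| < e].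
Proof.
move=> UU xM; have [|a [_ Ua]] := @segment_compact R (- M) M (x @ U) (fmap_proper_filter x _).
  apply: (@filterS _ U _ setT) filterT => n _ /=.
  by rewrite in_itv /= -ler_norml.
exists a => e e0.
have [//|Uc] := @in_ultra_setVsetC _ U [set n | `|x n - a| < e] UU.
have Vc : (x @ U) [set y | ~ `|y - a| < e] by apply: (@filterS _ U) Uc.
have Va : nbhs a (ball a e) by apply: nbhsx_ballx.
have [y [/= yV]] := Ua _ _ Vc Va.
by rewrite /ball /= distrC => /yV.
Qed.

(** Over the complex numbers, real and imaginary parts converge along the same ultrafilter, so no
    successive extraction of subsequences is needed. *)
Lemma ultra_bounded (U : set_system nat) (x : nat -> K) (M : R) :
  UltraFilter U -> (forall n, modulus (x n) <= M) ->
  exists a : K, forall e : R, 0 < e -> U [set n | modulus (x n - a) < e].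
Proof.
move: x; case: F => x UU /= xM; first exact: ultra_bounded_real xM.
have cRe (z : R[i]) : `|complex.Re z| <= complex.Re `|z|.
  by case: z => a b; rewrite normc_def /= -sqrtr_sqr ler_wsqrtr// lerDl sqr_ge0.
have cIm (z : R[i]) : `|complex.Im z| <= complex.Re `|z|.
  by case: z => a b; rewrite normc_def /= -sqrtr_sqr ler_wsqrtr// lerDr sqr_ge0.
have cRI (z : R[i]) : complex.Re `|z| <= `|complex.Re z| + `|complex.Im z|.
  case: z => a b; rewrite normc_def /= -ler_sqr ?nnegrE ?addr_ge0 //.
  rewrite sqr_sqrtr ?addr_ge0 ?sqr_ge0 // sqrrD !real_normK ?num_real //.
  rewrite addrAC lerDl mulrn_wge0 // mulr_ge0 //.
have [n|a Ha] := @ultra_bounded_real U (fun n => complex.Re (x n)) M UU.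
  exact: le_trans (cRe _) (xM n).
have [n|b Hb] := @ultra_bounded_real U (fun n => complex.Im (x n)) M UU.
  exact: le_trans (cIm _) (xM n).
exists (Complex a b) => e e0; have e2 : 0 < e / 2 by rewrite divr_gt0.
apply: filterS (filterI (Ha _ e2) (Hb _ e2)) => n [/= h1 h2].
apply: le_lt_trans (cRI _) _; rewrite [e]splitr.
by case: (x n) h1 h2 => p q /= h1 h2; rewrite ltrD.
Qed.

End Cluster.

(** * The l^1 norm, compactness, and comparison with the Euclidean and operator norms *)

Section EllOne.
Variables (R : realType) (F : ground_field) (d : nat).
Local Notation K := (base_field R F).
Implicit Types (u v w : 'cV[K]_d) (B : 'M[K]_d).

Definition l1 v : R := \sum_i modulus (v i 0).

Lemma l1_ge0 v : 0 <= l1 v.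
Proof. by apply: sumr_ge0 => i _; apply: modulus_ge0. Qed.

Lemma modulus_le_l1 v i : modulus (v i 0) <= l1 v.
Proof.
by rewrite /l1 (bigD1 i) //= lerDl; apply: sumr_ge0 => j _; apply: modulus_ge0.
Qed.

Lemma l1_0 : l1 0 = 0.
Proof. by apply: big1 => i _; rewrite mxE modulus0. Qed.

Lemma l1_eq0 v : l1 v = 0 -> v = 0.
Proof.
move=> v0; apply/matrixP => i j; rewrite (ord1 j) mxE.
by apply/eqP; rewrite -modulus_eq0 eq_le modulus_ge0 -v0 modulus_le_l1.
Qed.

Lemma l1_gt0 v : v != 0 -> 0 < l1 v.
Proof.
by move=> v0; rewrite lt_def l1_ge0 andbT; apply: contraNneq v0 => /l1_eq0 ->.
Qed.

Lemma l1Z c v : l1 (c *: v) = modulus c * l1 v.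
Proof. by rewrite /l1 mulr_sumr; apply: eq_bigr => i _; rewrite mxE modulusM. Qed.

Lemma l1D u v : l1 (u + v) <= l1 u + l1 v.
Proof.
by rewrite /l1 -big_split; apply: ler_sum => i _; rewrite mxE ler_modulusD.
Qed.

Lemma l1N v : l1 (- v) = l1 v.
Proof. by apply: eq_bigr => i _; rewrite mxE modulusN. Qed.

Lemma ler_l1_dist u v : l1 u <= l1 v + l1 (u - v).
Proof. by rewrite -{1}(subrK v u) addrC l1D. Qed.

(** All coordinates converge along one ultrafilter finer than [\oo]. It contains every tail, so
    indices close to the limit occur beyond any [m]. *)
Lemma l1_cluster (u : nat -> 'cV[K]_d) (M : R) : (forall n, l1 (u n) <= M) ->
  exists w, forall e, 0 < e -> forall m, exists2 n, (m <= n)%N & l1 (u n - w) < e.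
Proof.
move=> uM; have [U [UU Uoo]] := @ultraFilterLemma _ \oo _.
have /choice[a Ha] : forall i, exists a : K,
    forall e : R, 0 < e -> U [set n | modulus (u n i 0 - a) < e].
  by move=> i; apply: ultra_bounded => n; apply: le_trans (uM n); apply: modulus_le_l1.
exists (\col_i a i) => e e0 m.
(* Dividing by [d.+1] keeps [e'] positive when d = 0 and makes the sum of d errors strictly less
   than [e]. *)
pose e' := e / (d.+1)%:R; have e'0 : 0 < e' by rewrite divr_gt0.
have Um : U [set n | (m <= n)%N] by apply: Uoo; exists m.
have Ud : U [set n | forall i, modulus (u n i 0 - a i) < e'].
  by apply: (@filter_forall _ _ _ U) => i; apply: Ha.
have [n [/= mn Hn]] := @filter_ex _ U _ _ (filterI Um Ud).
exists n => //; apply: (@le_lt_trans _ _ (\sum_(i < d) e')).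
  by apply: ler_sum => i _; rewrite !mxE ltW.
rewrite sumr_const card_ord -mulr_natr /e' mulrAC ltr_pdivrMr // ltr_pM2l //.
by rewrite ltr_nat.
Qed.

Lemma const_mx1_neq0 : (0 < d)%N -> const_mx 1 != 0 :> 'cV[K]_d.
Proof.
move=> d_gt0; apply/eqP => /matrixP/(_ (Ordinal d_gt0) 0); rewrite !mxE => /eqP.
by rewrite oner_eq0.
Qed.

(** Subadditivity reduces everything to the finitely many basis vectors, so pointwise bounds on a
    family are uniform. A one-element family gives the continuity of a single seminorm. *)
Lemma uniform_seminorm_bound (T : Type) (N : T -> 'cV[K]_d -> R) :
  (forall t u v, N t (u + v) <= N t u + N t v) ->
  (forall t c v, N t (c *: v) <= modulus c * N t v) ->
  (forall v, exists M, forall t, N t v <= M) ->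
  exists2 c, 0 <= c & forall t v, N t v <= c * l1 v.
Proof.
move=> ND NZ NM.
have /choice[M HM] : forall i : 'I_d, exists M, forall t, N t (delta_mx i 0) <= M.
  by move=> i; apply: NM.
exists (\sum_i `|M i|) => [|t v]; first exact: sumr_ge0.
have N0 : N t 0 <= 0 by rewrite -(scale0r 0) (le_trans (NZ _ _ _)) // modulus0 mul0r.
rewrite {1}[v]matrix_sum_delta mulr_suml.
apply: (big_ind2 (fun (x : 'cV[K]_d) (y : R) => N t x <= y)) => // [x y x' y' h h'|i _].
  exact: le_trans (ND _ _ _) (lerD h h').
rewrite big_ord1; apply: le_trans (NZ _ _ _) _.
apply: (@le_trans _ _ (modulus (v i 0) * `|M i|)).
  by rewrite ler_wpM2l ?modulus_ge0 // (le_trans (HM i t)) // ler_norm.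
by rewrite mulrC ler_wpM2l // modulus_le_l1.
Qed.

Lemma l1_mulmx B : exists2 c, 0 <= c & forall v, l1 (B *m v) <= c * l1 v.
Proof.
have [|||c c0 Hc] := @uniform_seminorm_bound unit (fun _ v => l1 (B *m v)).
- by move=> _ u v; rewrite mulmxDr l1D.
- by move=> _ k v; rewrite -scalemxAr l1Z.
- by move=> v; exists (l1 (B *m v)).
by exists c => // v; apply: Hc tt v.
Qed.

Lemma euclidean_ge0 v : 0 <= euclidean_norm v.
Proof. exact: sqrtr_ge0. Qed.

Lemma euclideanZ c v : euclidean_norm (c *: v) = modulus c * euclidean_norm v.
Proof.
rewrite /euclidean_norm -(ger0_norm (modulus_ge0 c)) -sqrtr_sqr.
rewrite -sqrtrM ?sqr_ge0 // mulr_sumr; congr Num.sqrt.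
by apply: eq_bigr => i _; rewrite mxE modulusM exprMn.
Qed.

Lemma modulus_le_euclidean v i : modulus (v i 0) <= euclidean_norm v.
Proof.
rewrite -(ger0_norm (modulus_ge0 _)) -sqrtr_sqr ler_wsqrtr //.
by rewrite (bigD1 i) //= lerDl; apply: sumr_ge0 => j _; apply: sqr_ge0.
Qed.

Lemma l1_le_euclidean v : l1 v <= d%:R * euclidean_norm v.
Proof.
apply: (@le_trans _ _ (\sum_(i < d) euclidean_norm v)).
  by apply: ler_sum => i _; apply: modulus_le_euclidean.
by rewrite sumr_const card_ord mulr_natl.
Qed.

Lemma euclidean_le_l1 v : euclidean_norm v <= l1 v.
Proof.
rewrite -[leRHS]ger0_norm ?l1_ge0 // -sqrtr_sqr ler_wsqrtr //.
rewrite expr2 {1}/l1 mulr_suml; apply: ler_sum => i _.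
by rewrite expr2 ler_wpM2l ?modulus_ge0 ?modulus_le_l1.
Qed.

(** Ensures that the [sup] in [operator_norm] is a genuine supremum and not a default value. *)
Lemma has_ubound_operator_norm B :
  has_ubound [set euclidean_norm (B *m v) | v in [set v | euclidean_norm v <= 1]].
Proof.
have [c c0 Hc] := l1_mulmx B; exists (c * d%:R) => _ [v /= v1 <-].
apply: le_trans (euclidean_le_l1 _) _; apply: le_trans (Hc v) _.
rewrite ler_wpM2l // (le_trans (l1_le_euclidean _)) //.
by rewrite -[leRHS]mulr1 ler_wpM2l.
Qed.

Lemma operator_norm_ge0 B : 0 <= operator_norm B.
Proof.
apply: (le_trans (euclidean_ge0 (B *m 0))).
apply: (ub_le_sup (has_ubound_operator_norm B)).
by exists 0 => //=; rewrite (le_trans (euclidean_le_l1 _)) // l1_0.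
Qed.

Lemma operator_norm_le B c : 0 <= c ->
  (forall v, l1 (B *m v) <= c * l1 v) -> operator_norm B <= c * d%:R.
Proof.
move=> c0 Hc; apply: ge_sup.
  exists (euclidean_norm (B *m 0)); exists 0 => //=.
  by rewrite (le_trans (euclidean_le_l1 _)) // l1_0.
move=> _ [v /= v1 <-].
apply: le_trans (euclidean_le_l1 _) _; apply: le_trans (Hc v) _.
rewrite ler_wpM2l // (le_trans (l1_le_euclidean _)) //.
by rewrite -[leRHS]mulr1 ler_wpM2l.
Qed.

Lemma euclidean_mulmx B v :
  euclidean_norm (B *m v) <= operator_norm B * euclidean_norm v.
Proof.
have [e0|e0] := eqVneq (euclidean_norm v) 0.
  have -> : v = 0.
    apply/l1_eq0/eqP; rewrite eq_le l1_ge0 andbT.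
    by rewrite (le_trans (l1_le_euclidean v)) // e0 mulr0.
  rewrite mulmx0 (le_trans (euclidean_le_l1 _)) // l1_0.
  by rewrite mulr_ge0 ?operator_norm_ge0 ?euclidean_ge0.
have eV : 0 <= (euclidean_norm v)^-1 by rewrite invr_ge0 euclidean_ge0.
rewrite -ler_pdivrMr ?lt_def ?e0 ?euclidean_ge0 // mulrC.
rewrite -{1}(@modulus_of_real R F _ eV) -euclideanZ scalemxAr.
apply: (ub_le_sup (has_ubound_operator_norm B)).
exists (of_real F (euclidean_norm v)^-1 *: v) => //=.
by rewrite euclideanZ modulus_of_real // mulVf.
Qed.

Lemma l1_mulmx_operator_norm B v :
  l1 (B *m v) <= d%:R * operator_norm B * l1 v.
Proof.
apply: le_trans (l1_le_euclidean _) _; rewrite -mulrA ler_wpM2l //.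
apply: le_trans (euclidean_mulmx _ _) _.
by rewrite ler_wpM2l ?operator_norm_ge0 ?euclidean_le_l1.
Qed.

End EllOne.

(** * Factoring and concatenating products *)

Section Products.
Variables (R : realType) (F : ground_field) (d : nat).
Local Notation K := (base_field R F).
Variable A : set 'M[K]_d.
Implicit Types B C : 'M[K]_d.

Lemma products0 : products A 0 = [set 1%:M].
Proof.
apply/seteqP; split => [B [b _ <-]|B ->] /=; first by rewrite big_ord0.
by exists (fun=> 1%:M); [case | rewrite big_ord0].
Qed.

(** The factor split off is the one that acts first on a vector. *)
Lemma productsS n B :
  products A n.+1 B <-> exists C a, [/\ products A n C, A a & B = C *m a].
Proof.
have bigS m (b : 'I_m.+1 -> 'M[K]_d) : \big[mulmx/1%:M]_(i < m.+1) b i =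
    (\big[mulmx/1%:M]_(i < m) b (widen_ord (leqnSn m) i)) *m b ord_max.
  (* The product is read in the ring of square matrices, whose multiplication is [mulmx] up to
     conversion. *)
  exact: (@big_ord_recr _ 1%:M (@GRing.mul 'M[K]_d)).
split=> [[b Ab <-]|[C [a [[b Ab <-] Aa ->]]]].
  rewrite bigS; exists (\big[mulmx/1%:M]_(i < n) b (widen_ord (leqnSn n) i)), (b ord_max).
  by split=> //; exists (fun i => b (widen_ord (leqnSn n) i)) => // i; apply: Ab.
exists (fun i => if unlift ord_max i is Some j then b j else a).
  by move=> i /=; case: (unlift ord_max i).
rewrite bigS unlift_none; congr (_ *m _); apply: eq_bigr => i _.
have -> : widen_ord (leqnSn n) i = lift ord_max i by apply: val_inj; rewrite [RHS]lift_max.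
by rewrite liftK.
Qed.

Lemma productsD m n B C :
  products A m B -> products A n C -> products A (m + n) (B *m C).
Proof.
move=> PB; elim: n C => [|n IH] C; first by rewrite products0 => ->; rewrite addn0 mulmx1.
move=> /productsS[D [a [PD Aa ->]]]; rewrite addnS mulmxA.
by apply/productsS; exists (B *m D), a; split => //; apply: IH.
Qed.

Lemma products_nonempty n : A !=set0 -> products A n !=set0.
Proof.
move=> [a Aa]; elim: n => [|n [B PB]]; first by exists 1%:M; rewrite products0.
by exists (B *m a); apply/productsS; exists B, a.
Qed.

Lemma products_l1_le (M : R) n B v : 0 <= M ->
  (forall a u, A a -> l1 (a *m u) <= M * l1 u) -> products A n B ->
  l1 (B *m v) <= M ^+ n * l1 v.
Proof.
move=> M0 HM; elim: n B v => [|n IH] B v; first by rewrite products0 => ->; rewrite mul1mx expr0 mul1r.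
move=> /productsS[C [a [PC Aa ->]]]; rewrite -mulmxA exprSr -mulrA.
by apply: le_trans (IH _ _ PC) _; rewrite ler_wpM2l ?exprn_ge0 // HM.
Qed.

End Products.

(** * Growth rate of products, positivity of rho, relative product boundedness *)

Section Growth.
Variables (R : realType) (F : ground_field) (d : nat).
Local Notation K := (base_field R F).
Variable A : set 'M[K]_d.
Local Notation rho := (joint_spectral_radius A).
Implicit Types (B P Q : 'M[K]_d) (u v w : 'cV[K]_d).

Hypothesis A_nonempty : A !=set0.
Hypothesis A_bounded : bounded_matrices A.

Lemma bounded_matrices_l1 :
  exists2 M : R, 0 <= M & forall a u, A a -> l1 (a *m u) <= M * l1 u.
Proof.
case: A_bounded => M HM; exists (d%:R * `|M|) => [|a u Aa]; first by rewrite mulr_ge0.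
apply: le_trans (l1_mulmx_operator_norm _ _) _.
by rewrite ler_wpM2r ?l1_ge0 // ler_wpM2l // (le_trans (HM _ Aa)) // ler_norm.
Qed.

Lemma has_ubound_root_norms n :
  has_ubound [set operator_norm B `^ n%:R^-1 | B in products A n].
Proof.
have [M M0 HM] := bounded_matrices_l1.
exists ((M ^+ n * d%:R) `^ n%:R^-1) => _ [B PB <-].
have MB : operator_norm B <= M ^+ n * d%:R.
  by apply: operator_norm_le => [|v]; rewrite ?exprn_ge0 // (products_l1_le v M0 HM).
by apply: ge0_ler_powR; rewrite ?invr_ge0 // nnegrE ?operator_norm_ge0 ?mulr_ge0 ?exprn_ge0.
Qed.

(* A divergent sequence has [lim] equal to the junk value 0, so [rho != 0]
   already implies that the limit exists. *)
Lemma jsr_cvg : rho != 0 ->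
  (fun n : nat => sup [set operator_norm B `^ n%:R^-1 | B in products A n])
    @ \oo --> rho.
Proof. by move=> r0; apply: (@cvgNpoint R). Qed.

Lemma jsr_gt0 : rho != 0 -> 0 < rho.
Proof.
move=> r0; rewrite lt_def r0 /=; apply: (cvgr_to_ge (jsr_cvg r0)).
near=> n; have [B PB] := products_nonempty n A_nonempty.
apply: (le_trans (powR_ge0 (operator_norm B) n%:R^-1)).
by apply: (ub_le_sup (has_ubound_root_norms n)); exists B.
Unshelve. all: by end_near.
Qed.

Lemma operator_norm_growth q : rho != 0 -> rho < q ->
  exists m, forall n B, (m <= n)%N -> products A n B -> operator_norm B <= q ^+ n.
Proof.
move=> r0 rq; have [m _ Hm] := cvgr_lt _ (jsr_cvg r0) _ rq.
(* The successor excludes n = 0, where the n-th power would not undo the n-th root. *)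
exists m.+1 => n B mn PB; have n0 : (0 < n)%N by apply: leq_ltn_trans mn.
have q0 : 0 <= q by rewrite (le_trans _ (ltW rq)) // ltW // jsr_gt0.
have Bq : operator_norm B `^ n%:R^-1 <= q.
  apply: le_trans (ltW (Hm n (ltnW mn))).
  by apply: (ub_le_sup (has_ubound_root_norms n)); exists B.
have -> : operator_norm B = (operator_norm B `^ n%:R^-1) ^+ n.
  by rewrite -powR_mulrn ?powR_ge0 // -powRrM mulVf ?pnatr_eq0 ?lt0n_neq0 // powRr1 ?operator_norm_ge0.
by rewrite lerXn2r ?nnegrE ?powR_ge0.
Qed.

Lemma l1_mulmx_entries B v e : (forall i j, modulus (B i j) <= e) ->
  l1 (B *m v) <= d%:R * e * l1 v.
Proof.
move=> Be; apply: (@le_trans _ _ (\sum_(i < d) e * l1 v)); last first.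
  by rewrite sumr_const card_ord -mulrA mulr_natl.
apply: ler_sum => i _; rewrite mxE mulr_sumr.
apply: (big_ind2 (fun (x : K) (y : R) => modulus x <= y)).
- by rewrite modulus0.
- by move=> x y x' y' h h'; apply: le_trans (ler_modulusD _ _) (lerD h h').
by move=> j _; rewrite modulusM ler_wpM2r ?modulus_ge0.
Qed.

(** Closeness in the matrix topology is entrywise; entries of size at most [e'] cost at most d *
    [e'] <= [e] in l^1 norm. *)
Lemma limit_semigroup_approx B m e : limit_semigroup A B -> 0 < e ->
  exists n P, [/\ (m <= n)%N, (0 < n)%N, products A n P &
    forall v, l1 (of_real F (rho ^- n) *: (P *m v) - B *m v) <= e * l1 v].
Proof.
move=> SB e0; pose e' := e / d.+1%:R.
have e'0 : 0 < e' by rewrite divr_gt0.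
have e'K : 0 < of_real F e' by rewrite -(of_real0 R F) ltr_of_real.
(* Index [m.+1] lies in the range of the intersection even for m = 0, and it forces 0 < n. *)
have [_ [[n mn [P PP <-]] BP]] := SB m.+1 isT _ (nbhsx_ballx B _ e'K).
exists n, P; split=> [|||v] //; first exact: ltnW; first exact: leq_ltn_trans mn.
rewrite scalemxAl -mulmxBl; apply: le_trans (@l1_mulmx_entries _ _ e' _) _.
  move=> i j; have := BP.2 i j; rewrite /ball /= norm_modulus ltr_of_real => /ltW.
  by rewrite -opprB modulusN !mxE.
rewrite ler_wpM2r ?l1_ge0 // /e' mulrCA ger_pMr //.
by rewrite ler_pdivrMr // mul1r ler_nat.
Qed.

(** Dichotomy: either some [m] bounds the length needed to expand every nonzero vector by more than
    4 rho^n, which contradicts the growth rate, or for each [m] a unit vector resists all products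
    of length up to [m], and these vectors cluster at [w]. *)
Lemma bounded_orbit_of_slow_growth : 0 < rho -> (0 < d)%N ->
  exists w (M : R), w != 0 /\
    forall n B, products A n B -> l1 (B *m w) <= M * rho ^+ n.
Proof.
move=> r0 d0.
have [[m Hm]|Hm] := pselect (exists m, forall v, v != 0 ->
  exists n B, [/\ (n <= m)%N, products A n B & 4 * rho ^+ n * l1 v < l1 (B *m v)]).
  exfalso; pose v : 'cV[K]_d := const_mx 1.
  have v0 : v != 0 by apply: const_mx1_neq0.
  (* Chaining k expansions gains 4^k with a total length between k and k * m. *)
  have Hk k : exists n B, [/\ (n <= k * m)%N, (k <= n)%N, products A n B &
      4 ^+ k * rho ^+ n * l1 v <= l1 (B *m v)].
    elim: k => [|k [n [B [nk kn PB HB]]]].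
      by exists 0, 1%:M; rewrite products0 !expr0 !mul1r mul1mx.
    have Bv0 : B *m v != 0.
      apply: contraTneq HB => ->; rewrite l1_0 -ltNge.
      by rewrite !mulr_gt0 ?exprn_gt0 ?l1_gt0.
    have [n' [C [nm PC HC]]] := Hm _ Bv0; exists (n' + n)%N, (C *m B).
    (* The empty product is the identity, which cannot expand by 4. *)
    have n'0 : (0 < n')%N.
      case: n' PC HC {nm} => // ; rewrite products0 => -> /=.
      rewrite mul1mx expr0 mulr1; have := l1_ge0 (B *m v); lra.
    split; first by rewrite mulSn leq_add.
    - by rewrite -add1n leq_add.
    - exact: productsD.
    rewrite -mulmxA; apply: le_trans (ltW HC).
    rewrite exprS exprD -!mulrA ler_pM2l // [4 ^+ k * _]mulrCA ler_pM2l ?exprn_gt0 //.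
    by rewrite mulrA.
  (* With q^(m+1) = 2, lengths n <= k * m give q^n <= 2^k, too slow for the gain 4^k. *)
  pose q : R := 2 `^ m.+1%:R^-1.
  have qm : q ^+ m.+1 = 2.
    by rewrite -powR_mulrn ?powR_ge0 // -powRrM mulVf ?pnatr_eq0 // powRr1.
  have q1 : 1 < q.
    rewrite ltNge; apply/negP => q1; have := exprn_ile1 m.+1 (powR_ge0 2 m.+1%:R^-1) q1.
    by rewrite qm; lra.
  have [n0 Hn0] : exists m, forall n B, (m <= n)%N -> products A n B ->
      operator_norm B <= (q * rho) ^+ n.
    by apply: operator_norm_growth; rewrite ?gt_eqF // ltr_pMl.
  (* [n0] makes the growth bound applicable; [d] refutes the resulting 2^k <= d. *)
  pose k := maxn n0 d.
  have [n [B [nk kn PB HB]]] := Hk k.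
  have := Hn0 n B (leq_trans (leq_maxl _ _) kn) PB => HB'.
  have : 4 ^+ k * rho ^+ n * l1 v <= d%:R * (q ^+ n * rho ^+ n) * l1 v.
    apply: le_trans HB _; apply: le_trans (l1_mulmx_operator_norm _ _) _.
    by rewrite ler_wpM2r ?l1_ge0 // ler_wpM2l // -exprMn.
  rewrite ler_pM2r ?l1_gt0 // mulrA ler_pM2r ?exprn_gt0 //.
  have qn : q ^+ n <= 2 ^+ k.
    rewrite -qm -exprM mulnC ler_weXn2l ?ltW //.
    by apply: leq_trans nk _; rewrite leq_mul2l leqnSn orbT.
  have h4 : 4 ^+ k = 2 ^+ k * 2 ^+ k :> R by rewrite -exprMn -natrM.
  rewrite h4 => h; have {h} : 2 ^+ k * 2 ^+ k <= d%:R * 2 ^+ k :> R.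
    by apply: le_trans h _; rewrite ler_wpM2l.
  rewrite ler_pM2r ?exprn_gt0 // -natrX ler_nat leqNgt.
  by rewrite (leq_trans _ (ltn_expl k (ltnSn 1))) // ltnS leq_maxr.
have /choice[v Hv] : forall m, exists v, l1 v = 1 /\
    forall n B, (n <= m)%N -> products A n B -> l1 (B *m v) <= 4 * rho ^+ n.
  move=> m; move/forallNP/(_ m)/existsNP: Hm => [v /not_implyP[v0 Hv]].
  have s0 : 0 <= (l1 v)^-1 by rewrite invr_ge0 l1_ge0.
  have vn0 : 0 < l1 v by rewrite l1_gt0.
  exists (of_real F (l1 v)^-1 *: v); split.
    by rewrite l1Z modulus_of_real // mulVf // gt_eqF.
  move=> n B nm PB; rewrite -scalemxAr l1Z modulus_of_real // mulrC ler_pdivrMr //.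
  by rewrite leNgt; apply/negP => h; apply: Hv; exists n, B.
have [w Hw] : exists w, forall e, 0 < e -> forall m, exists2 n, (m <= n)%N & l1 (v n - w) < e.
  by apply: (@l1_cluster _ _ _ _ 1) => n; case: (Hv n) => ->.
(* The constant is 4 from the nearby unit vector [v k], plus 1 for the error of replacing [w] by
   it. *)
exists w, 5; split.
  have [n _ h] := Hw 1 ltr01 0%N; apply/eqP => w0; move: h.
  by rewrite w0 subr0; case: (Hv n) => ->; rewrite ltxx.
move=> n B PB; have [c c0 Hc] := l1_mulmx B.
have rn : 0 < rho ^+ n by rewrite exprn_gt0.
have e0 : 0 < rho ^+ n / (c + 1) by rewrite divr_gt0 // ltr_wpDl.
have [k nk hk] := Hw _ e0 n.
apply: le_trans (ler_l1_dist (B *m w) (B *m v k)) _.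
have -> : 5 * rho ^+ n = 4 * rho ^+ n + rho ^+ n by ring.
apply: lerD; first by case: (Hv k) => _; apply.
rewrite -mulmxBr -opprB mulmxN l1N; apply: le_trans (Hc _) _.
move: hk; rewrite ltr_pdivlMr ?ltr_wpDl // => /ltW; apply: le_trans.
by rewrite mulrC ler_wpM2l ?l1_ge0 // lerDl.
Qed.

Definition transitive_semigroup := forall v1 v2 : 'cV[K]_d, v1 != 0 -> v2 != 0 ->
  exists B1 B2 : 'M[K]_d, exists lambda : K,
    [/\ limit_semigroup A B1, limit_semigroup A B2, lambda != 0,
        B1 *m v1 = lambda *: v2 & B2 *m v2 = lambda^-1 *: v1].

Hypothesis d_gt0 : (0 < d)%N.
Hypothesis A_transitive : transitive_semigroup.

Lemma transitive_jsr_gt0 : 0 < rho.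
Proof.
apply: jsr_gt0; apply/eqP => r0; pose v : 'cV[K]_d := const_mx 1.
have v0 : v != 0 by apply: const_mx1_neq0.
have [B [_ [l [SB _ l0 Bv _]]]] := A_transitive v0 v0.
have Bv0 : 0 < l1 (B *m v) by rewrite Bv l1_gt0 // scaler_eq0 negb_or l0.
have vn0 : 0 < l1 v by rewrite l1_gt0.
have e0 : 0 < l1 (B *m v) / (2 * l1 v) by rewrite divr_gt0 // mulr_gt0.
have [n [P [_ n0 _ /(_ v)]]] := limit_semigroup_approx 0 SB e0.
(* With rho = 0 and n > 0 the scaling factor is 0 by convention, so the approximant vanishes and |B
   v| <= |B v| / 2. *)
rewrite r0 expr0n gtn_eqF // invr0 of_real0 scale0r sub0r l1N.
have -> : l1 (B *m v) / (2 * l1 v) * l1 v = l1 (B *m v) / 2.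
  by field; rewrite gt_eqF.
by lra.
Qed.

(** If B w = lambda v and B is close to rho^-k Q, then P v is controlled by P Q w, which lies on the
    bounded orbit of [w]. The pointwise bounds then become uniform over all products, indexed by
    [T]. *)
Lemma relatively_product_bounded : exists2 C, 0 <= C &
  forall n B v, products A n B -> l1 (B *m v) <= C * rho ^+ n * l1 v.
Proof.
have r0 := transitive_jsr_gt0.
have [w [M [w0 HM]]] := bounded_orbit_of_slow_growth r0 d_gt0.
pose T := {p : nat * 'M[K]_d | products A p.1 p.2}.
have [|||C C0 HC] := @uniform_seminorm_bound R F d T
  (fun t v => rho ^- (sval t).1 * l1 ((sval t).2 *m v)).
- move=> t u v; rewrite mulmxDr -mulrDr ler_wpM2l ?l1D //.
  by rewrite invr_ge0 exprn_ge0 // ltW.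
- by move=> t c v; rewrite -scalemxAr l1Z mulrCA.
- move=> v; have [->|v0] := eqVneq v 0.
    by exists 0 => t; rewrite mulmx0 l1_0 mulr0.
  have [B [_ [l [SB _ l0 Bw _]]]] := A_transitive w0 v0.
  have l0' : 0 < modulus l by rewrite lt_def modulus_ge0 modulus_eq0 l0.
  (* [M] bounds the orbit of [w], 1 absorbs the approximation error, and |lambda| converts B w into
     v. *)
  exists ((M + 1) / modulus l) => -[[n P] /= PP].
  have rn : 0 < rho ^+ n by rewrite exprn_gt0.
  rewrite ler_pdivlMr // mulrAC -mulrA -l1Z scalemxAr -Bw.
  rewrite mulrC ler_pdivrMr //.
  have [c c0 Hc] := l1_mulmx P.
  have wn0 : 0 < l1 w by rewrite l1_gt0.
  have e0 : 0 < rho ^+ n / ((c + 1) * l1 w) by rewrite divr_gt0 // mulr_gt0 // ltr_wpDl.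
  have [k [Q [_ _ PQ /(_ w) HQ]]] := limit_semigroup_approx 0 SB e0.
  set z := _ *: _ in HQ.
  apply: le_trans (ler_l1_dist _ (P *m z)) _.
  rewrite mulrDl mul1r; apply: lerD.
    rewrite /z -scalemxAr mulmxA l1Z modulus_of_real ?invr_ge0 ?exprn_ge0 ?(ltW r0) //.
    rewrite mulrC ler_pdivrMr ?exprn_gt0 // -mulrA -exprD.
    by apply: HM; apply: productsD.
  rewrite -mulmxBr -opprB mulmxN l1N; apply: le_trans (Hc _) _.
  have {}HQ : l1 (z - B *m w) <= rho ^+ n / (c + 1).
    apply: le_trans HQ _; rewrite le_eqVlt; apply/orP; left; apply/eqP.
    by field; rewrite !gt_eqF // ltr_wpDl.
  move: HQ; rewrite ler_pdivlMr ?ltr_wpDl //; apply: le_trans.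
  by rewrite mulrC ler_wpM2l ?l1_ge0 // lerDl.
exists C => // n B v PB; have := HC (exist _ (n, B) PB) v => /=.
by rewrite mulrC ler_pdivrMr ?exprn_gt0 // => h; rewrite mulrAC.
Qed.

End Growth.

(** * The limsup norm is a Barabanov norm *)

Section Existence.
Variables (R : realType) (F : ground_field) (d : nat).
Local Notation K := (base_field R F).
Variable A : set 'M[K]_d.
Local Notation rho := (joint_spectral_radius A).
Implicit Types (B P Q : 'M[K]_d) (u v w : 'cV[K]_d).

Hypothesis A_nonempty : A !=set0.
Hypothesis A_bounded : bounded_matrices A.
Hypothesis d_gt0 : (0 < d)%N.
Hypothesis A_transitive : transitive_semigroup A.

Let rho_gt0 : 0 < rho := transitive_jsr_gt0 A_nonempty A_bounded d_gt0 A_transitive.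

Let rhoX_gt0 n : 0 < rho ^+ n.
Proof. by rewrite exprn_gt0. Qed.

(** The infimum of this set is the limsup over n of the supremum of rho^-n |B v|; [0 <= x] supplies
    its lower bound. *)
Definition eventual_bounds v : set R := [set x | 0 <= x /\
  exists m, forall n B, (m <= n)%N -> products A n B ->
    l1 (B *m v) <= x * rho ^+ n].

Definition limsup_norm v : R := inf (eventual_bounds v).

Lemma eventual_bounds_nonempty v : eventual_bounds v !=set0.
Proof.
have [C C0 HC] := relatively_product_bounded A_nonempty A_bounded d_gt0 A_transitive.
exists (C * l1 v); split; first by rewrite mulr_ge0 ?l1_ge0.
by exists 0%N => n B _ PB; rewrite mulrAC HC.
Qed.

Lemma limsup_norm_le v x : eventual_bounds v x -> limsup_norm v <= x.
Proof. by move=> vx; apply: ge_inf vx; exists 0 => y []. Qed.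

Lemma limsup_norm_lt v x : limsup_norm v < x -> eventual_bounds v x.
Proof.
move=> /(inf_lt (eventual_bounds_nonempty v))[y [y0 [m Hm]] yx].
split; first exact: le_trans y0 (ltW yx).
exists m => n B mn PB; apply: le_trans (Hm n B mn PB) _.
by rewrite ler_pM2r // ltW.
Qed.

Lemma limsup_norm_ge0 v : 0 <= limsup_norm v.
Proof. by apply: lb_le_inf (eventual_bounds_nonempty v) _ => x []. Qed.

(** Arbitrarily long scaled products approximate some B with B v nonzero, so their values on v
    cannot all become small. Two errors of a quarter of |B v| suffice. *)
Lemma limsup_norm_definite v : limsup_norm v = 0 -> v = 0.
Proof.
move=> Nv; apply/eqP/negP => /negP v0.
have [B [_ [l [SB _ l0 Bv _]]]] := A_transitive v0 v0.
have vn0 := l1_gt0 v0.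
have Bv0 : 0 < l1 (B *m v) by rewrite Bv l1_gt0 // scaler_eq0 negb_or l0.
have /limsup_norm_lt[_ [m Hm]] : limsup_norm v < l1 (B *m v) / 4.
  by rewrite Nv divr_gt0.
have e0 : 0 < l1 (B *m v) / (4 * l1 v) by rewrite divr_gt0 // mulr_gt0.
have [n [P [mn _ PP /(_ v) HP]]] := limit_semigroup_approx m SB e0.
move: HP; have -> : l1 (B *m v) / (4 * l1 v) * l1 v = l1 (B *m v) / 4.
  by field; rewrite gt_eqF.
have := Hm n P mn PP; rewrite -ler_pdivrMr //.
have := ler_l1_dist (B *m v) (of_real F (rho ^- n) *: (P *m v)).
rewrite -opprB l1N l1Z modulus_of_real ?invr_ge0 ?(ltW (rhoX_gt0 n)) // mulrC.
by lra.
Qed.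

Lemma limsup_normZ_le c v : limsup_norm (c *: v) <= modulus c * limsup_norm v.
Proof.
apply/ler_addgt0Pr => e e0.
have e1 : 0 < e / (modulus c + 1) by rewrite divr_gt0 // ltr_wpDl ?modulus_ge0.
have /limsup_norm_lt[x0 [m Hm]] : limsup_norm v < limsup_norm v + e / (modulus c + 1).
  by rewrite ltrDl.
apply: (@le_trans _ _ (modulus c * (limsup_norm v + e / (modulus c + 1)))).
  apply: limsup_norm_le; split; first by rewrite mulr_ge0 ?modulus_ge0.
  exists m => n B mn PB; rewrite -scalemxAr l1Z -mulrA.
  by rewrite ler_wpM2l ?modulus_ge0 // Hm.
rewrite mulrDr lerD2l mulrCA ger_pMr // ler_pdivrMr ?ltr_wpDl ?modulus_ge0 //.
by rewrite mul1r lerDl.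
Qed.

(** The reverse inequality is [limsup_normZ_le] for [c^-1] and [c *: v]. *)
Lemma limsup_normZ c v : limsup_norm (c *: v) = modulus c * limsup_norm v.
Proof.
apply/eqP; rewrite eq_le limsup_normZ_le /=.
have [->|c0] := eqVneq c 0; first by rewrite modulus0 mul0r limsup_norm_ge0.
have m0 : 0 < modulus c by rewrite lt_def modulus_ge0 modulus_eq0 c0.
rewrite -ler_pdivlMl // -modulusV; apply: le_trans (limsup_normZ_le _ _).
by rewrite scalerA mulVf // scale1r.
Qed.

Lemma limsup_normD u v : limsup_norm (u + v) <= limsup_norm u + limsup_norm v.
Proof.
apply/ler_addgt0Pr => e e0; have e2 : 0 < e / 2 by rewrite divr_gt0.
have /limsup_norm_lt[x0 [m Hm]] : limsup_norm u < limsup_norm u + e / 2.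
  by rewrite ltrDl.
have /limsup_norm_lt[y0 [p Hp]] : limsup_norm v < limsup_norm v + e / 2.
  by rewrite ltrDl.
rewrite [e]splitr addrACA; apply: limsup_norm_le; split; first exact: addr_ge0.
exists (maxn m p) => n B; rewrite geq_max => /andP[mn pn] PB.
by rewrite mulmxDr mulrDl (le_trans (l1D _ _)) // lerD ?Hm ?Hp.
Qed.

(** Appending B turns a product of length n into one of length n + 1, which accounts for the factor
    rho. *)
Lemma limsup_norm_mulmx_le B v : A B -> limsup_norm (B *m v) <= rho * limsup_norm v.
Proof.
move=> AB; rewrite mulrC -ler_pdivrMr //; apply/ler_addgt0Pr => e e0.
have /limsup_norm_lt[x0 [m Hm]] : limsup_norm v < limsup_norm v + e.
  by rewrite ltrDl.
rewrite ler_pdivrMr //; apply: limsup_norm_le; split; first by rewrite mulr_ge0 // ltW.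
exists m => n C mn PC; rewrite mulmxA -mulrA -exprS Hm //; first exact: leqW.
by apply/productsS; exists C, B.
Qed.

(* Long products almost attaining [limsup_norm v] factor as [C *m a] with [a]
   in [A]; along a subsequence [a *m v] converges, so a single [a] serves for
   all of them up to a small error. *)
Lemma limsup_norm_le_sup v :
  rho * limsup_norm v <= sup [set limsup_norm (B *m v) | B in A].
Proof.
set s := sup _.
have s_ub B : A B -> limsup_norm (B *m v) <= s.
  move=> AB; apply: (@ub_le_sup _ [set limsup_norm (B *m v) | B in A]); last by exists B.
  by exists (rho * limsup_norm v) => _ [C AC <-]; apply: limsup_norm_mulmx_le.
have s_ge0 : 0 <= s.
  by have [B AB] := A_nonempty; apply: le_trans (limsup_norm_ge0 _) (s_ub B AB).
rewrite leNgt; apply/negP => sN.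
(* [t] is the midpoint of the supposed gap between [s] and rho times the norm of v. *)
pose t := (s + rho * limsup_norm v) / 2; pose del := t - s.
have del0 : 0 < del by rewrite /del /t; lra.
have tN : t / rho < limsup_norm v by rewrite ltr_pdivrMr // mulrC /t; lra.
have t0 : 0 <= t by rewrite /t; lra.
have /choice[f Hf] : forall k, exists f : nat * 'M[K]_d * 'M[K]_d,
    [/\ (k <= f.1.1)%N, products A f.1.1 f.1.2, A f.2 &
        t * rho ^+ f.1.1 < l1 (f.1.2 *m (f.2 *m v))].
  move=> k; apply: contrapT => nf; move: tN; apply/negP; rewrite -leNgt.
  apply: limsup_norm_le; split; first by rewrite divr_ge0 // ltW.
  exists k.+1 => -[//|n] B kn /productsS[C [a [PC Aa ->]]].
  rewrite exprS mulrA divfK ?gt_eqF // -mulmxA leNgt; apply/negP => h.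
  by apply: nf; exists (n, C, a).
have [M M0 HM] := bounded_matrices_l1 A_bounded.
have [|w Hw] := @l1_cluster _ _ _ (fun k => (f k).2 *m v) (M * l1 v).
  by move=> k; apply: HM; case: (Hf k).
have [C C0 HC] := relatively_product_bounded A_nonempty A_bounded d_gt0 A_transitive.
pose e := del / 2 / (2 * (C + 1)).
have C1 : 0 < 2 * (C + 1) by rewrite mulr_gt0 // ltr_wpDl.
have e0 : 0 < e by rewrite !divr_gt0.
(* [j] is fixed first, so that the threshold [m] for the single vector (f j).2 v is known before [k]
   is chosen beyond it. *)
have [j _ jw] := Hw _ e0 0%N.
have [_ _ Aj _] := Hf j.
have /limsup_norm_lt[_ [m Hm]] : limsup_norm ((f j).2 *m v) < s + del / 2.
  by apply: le_lt_trans (s_ub _ Aj) _; rewrite ltrDl divr_gt0.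
have [k mk kw] := Hw _ e0 m.
have [kn Pk Ak] := Hf k; apply/negP; rewrite -leNgt.
(* Replacing a_k by a_j costs [del / 2], and the eventual bound for a_j v is s + [del / 2]; together
   they give t, against the choice of f k. *)
apply: le_trans (ler_l1_dist _ ((f k).1.2 *m ((f j).2 *m v))) _.
apply: le_trans (lerD (Hm _ _ (leq_trans mk kn) Pk) (lexx _)) _.
rewrite -mulmxBr; apply: le_trans (lerD (lexx _) (HC _ _ _ Pk)) _.
rewrite mulrAC -mulrDl ler_pM2r //.
have h : l1 ((f k).2 *m v - (f j).2 *m v) <= 2 * e.
  have -> : (f k).2 *m v - (f j).2 *m v = ((f k).2 *m v - w) + - ((f j).2 *m v - w).
    by rewrite opprB addrA subrK.
  by apply: le_trans (l1D _ _) _; rewrite l1N; lra.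
have : C * l1 ((f k).2 *m v - (f j).2 *m v) <= del / 2.
  apply: le_trans (ler_wpM2l C0 h) _.
  have -> : del / 2 = (C + 1) * (2 * e) by rewrite /e; field; rewrite gt_eqF // ltr_wpDl.
  by rewrite ler_wpM2r ?lerDl // mulr_ge0 // ltW.
by rewrite /del; lra.
Qed.

Lemma limsup_norm_barabanov : barabanov_norm A limsup_norm.
Proof.
split; first split.
- exact: limsup_norm_ge0.
- exact: limsup_norm_definite.
- exact: limsup_normZ.
- exact: limsup_normD.
move=> v; apply/eqP; rewrite eq_le limsup_norm_le_sup /=.
apply: ge_sup => [|_ [B AB <-]]; last exact: limsup_norm_mulmx_le.
by have [B AB] := A_nonempty; exists (limsup_norm (B *m v)), B.
Qed.

End Existence.

(** * Limit semigroup elements contract every Barabanov norm *)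

Section Uniqueness.
Variables (R : realType) (F : ground_field) (d : nat).
Local Notation K := (base_field R F).
Variable A : set 'M[K]_d.
Local Notation rho := (joint_spectral_radius A).
Implicit Types (B P : 'M[K]_d) (v : 'cV[K]_d).

Hypothesis A_bounded : bounded_matrices A.
Hypothesis rho_gt0 : 0 < rho.
Variable N : 'cV[K]_d -> R.
Hypothesis N_barabanov : barabanov_norm A N.

Lemma norm_le_l1 : exists2 c, 0 <= c & forall v, N v <= c * l1 v.
Proof.
have [[N0 _ NZ ND] _] := N_barabanov.
have [|||c c0 Hc] := @uniform_seminorm_bound R F d unit (fun=> N).
- by move=> _; apply: ND.
- by move=> _ c v; rewrite NZ.
- by move=> v; exists (N v).
by exists c => // v; apply: Hc tt v.
Qed.

(** The supremum bounds its members only if the set is bounded above, which follows from comparing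
    [N] with l^1. *)
Lemma barabanov_mulmx_le B v : A B -> N (B *m v) <= rho * N v.
Proof.
move=> AB; have [_ ->] := N_barabanov.
apply: (@ub_le_sup _ [set N (B *m v) | B in A]); last by exists B.
have [c c0 Hc] := norm_le_l1; have [M M0 HM] := bounded_matrices_l1 A_bounded.
exists (c * (M * l1 v)) => _ [C AC <-].
by apply: le_trans (Hc _) _; rewrite ler_wpM2l // HM.
Qed.

Lemma barabanov_products_le n B v : products A n B -> N (B *m v) <= rho ^+ n * N v.
Proof.
elim: n B v => [|n IH] B v; first by rewrite products0 => ->; rewrite mul1mx mul1r.
move=> /productsS[C [a [PC Aa ->]]]; rewrite -mulmxA exprSr -mulrA.
apply: le_trans (IH _ _ PC) _.
by rewrite ler_wpM2l ?exprn_ge0 ?barabanov_mulmx_le // ltW.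
Qed.

(** Scaled products contract [N], and domination of [N] by l^1 carries this to the limit. *)
Lemma barabanov_limit_semigroup_le B v : limit_semigroup A B -> N (B *m v) <= N v.
Proof.
move=> SB; have [[N0 _ NZ ND] _] := N_barabanov.
have [c c0 Hc] := norm_le_l1.
apply/ler_addgt0Pr => e e0.
have cv : 0 <= c * l1 v by rewrite mulr_ge0 ?l1_ge0.
(* The added 1 covers the case c * |v| = 0. *)
have e1 : 0 < e / (c * l1 v + 1) by rewrite divr_gt0 // ltr_wpDl.
have [n [P [_ _ PP /(_ v)]]] := limit_semigroup_approx 0 SB e1.
set z := _ *: _ => Hz; rewrite -[B *m v](subKr z) opprB addrC.
apply: le_trans (ND _ _) _; rewrite addrC; apply: lerD.
  rewrite /z NZ modulus_of_real ?invr_ge0 ?exprn_ge0 ?(ltW rho_gt0) //.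
  by rewrite mulrC ler_pdivrMr ?exprn_gt0 // mulrC barabanov_products_le.
apply: le_trans (Hc _) _; rewrite -opprB l1N.
apply: le_trans (ler_wpM2l c0 Hz) _.
have -> : c * (e / (c * l1 v + 1) * l1 v) = e * (c * l1 v) / (c * l1 v + 1).
  by ring.
by rewrite ler_pdivrMr ?ltr_wpDl // ler_pM2l // lerDl.
Qed.

Lemma barabanov_ratio v1 v2 B1 B2 lambda :
  limit_semigroup A B1 -> limit_semigroup A B2 -> lambda != 0 ->
  B1 *m v1 = lambda *: v2 -> B2 *m v2 = lambda^-1 *: v1 ->
  N v1 = modulus lambda * N v2.
Proof.
move=> S1 S2 l0 h1 h2; have [[_ _ NZ _] _] := N_barabanov.
have m0 : 0 < modulus lambda by rewrite lt_def modulus_ge0 modulus_eq0 l0.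
apply/eqP; rewrite eq_le -NZ -h1 barabanov_limit_semigroup_le // andbT h1 NZ.
by rewrite -ler_pdivrMl // -modulusV -NZ -h2 barabanov_limit_semigroup_le.
Qed.

End Uniqueness.

Theorem theorem2p1 (R : realType) (F : ground_field) (d : nat)
  (d_ge1 : (1 <= d)%N) (A : set 'M[base_field R F]_d)
  (A_nonempty : A !=set0) (A_bounded : bounded_matrices A)
  (A_irreducible : irreducible_matrices A)
  (A_transitive : forall v1 v2 : 'cV[base_field R F]_d, v1 != 0 -> v2 != 0 ->
     exists B1 B2 : 'M[base_field R F]_d, exists lambda : base_field R F,
       [/\ limit_semigroup A B1, limit_semigroup A B2, lambda != 0,
           B1 *m v1 = lambda *: v2 & B2 *m v2 = lambda^-1 *: v1]) :
  has_unique_barabanov_norm A.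
Proof.
have r0 := transitive_jsr_gt0 A_nonempty A_bounded d_ge1 A_transitive.
split.
  exists (limsup_norm A).
  exact: limsup_norm_barabanov A_nonempty A_bounded d_ge1 A_transitive.
move=> N1 N2 bN1 bN2; pose v0 : 'cV[base_field R F]_d := const_mx 1.
have v0_neq0 : v0 != 0 by apply: const_mx1_neq0.
have norm_gt0 N : barabanov_norm A N -> 0 < N v0.
  move=> [[N_ge0 N_def _ _] _]; rewrite lt_def N_ge0 andbT.
  by apply: contraNneq v0_neq0 => /N_def ->.
exists (N2 v0 / N1 v0) => [|v]; first by rewrite divr_gt0 ?norm_gt0.
have [->|v_neq0] := eqVneq v 0.
  have [[_ _ N1Z _] _] := bN1; have [[_ _ N2Z _] _] := bN2.
  by rewrite -(scale0r 0) N1Z N2Z modulus0 !mul0r mulr0.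
(* One [lambda] serves both norms, so it cancels and the ratio at v equals the ratio at [v0]. *)
have [B1 [B2 [lambda [S1 S2 l0 h1 h2]]]] := A_transitive v v0 v_neq0 v0_neq0.
rewrite (barabanov_ratio A_bounded r0 bN1 S1 S2 l0 h1 h2).
rewrite (barabanov_ratio A_bounded r0 bN2 S1 S2 l0 h1 h2).
by rewrite mulrCA divfK // gt_eqF ?norm_gt0.
Qed.
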